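(* Let $G_1$ and $G_2$ be vertex disjoint graphs with independence polynomials $I(G_1;x)=\sum_{i=0}^{\alpha(G_1)}a_ix^i$ and $I(G_2;x)=\sum_{i=0}^{\alpha(G_2)}b_ix^i$, and let $G_1[G_2]$ denote their lexicographic product. (i) Assume that $I(G_1;x)$ and $I(G_2;x)$ are log-concave. If $(a_i^2-a_{i-1}a_{i+1})b_1^2\geq a_ia_{i-1}b_2$ for all $1\leq i\leq\alpha(G_1)$, then $I(G_1[G_2];x)$ is log-concave. (ii) Assume that $I(G_2;x)$ is log-concave. If $a_{i-1}\leq b_1a_i$ for all $1\leq i\leq\alpha(G_1)$, then $I(G_1[G_2];x)$ is unimodal. In particular, if $a_i$ is increasing in $i$ (for $0\le i\le\alpha(G_1)$), then $I(G_1[G_2];x)$ is unimodal.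
   Context: All graphs are finite and simple. An independent set of a graph $G$ is a set of pairwise non-adjacent vertices; $\alpha(G)$ is the size of a largest independent set. The independence polynomial is $I(G;x)=\sum_{k=0}^{\alpha(G)}i_k(G)x^k$, where $i_k(G)$ is the number of independent sets of cardinality $k$ in $G$ and $i_0(G)=1$. The lexicographic product $G_1[G_2]$ is the graph with vertex set $V(G_1)\times V(G_2)$ in which $(a,x)$ is adjacent to $(b,y)$ if and only if $a$ is adjacent to $b$ in $G_1$, or $a=b$ and $x$ is adjacent to $y$ in $G_2$. A polynomial $\sum_{k=0}^n c_kx^k$ with nonnegative coefficients is unimodal if there is some $m$ with $c_0\le c_1\le\cdots\le c_m\ge c_{m+1}\ge\cdots\ge c_n$; it is log-concave if $c_k^2\ge c_{k-1}c_{k+1}$ for all $1\le k\le n-1$. Convention: coefficients beyond the degree are zero, i.e. $a_{\alpha(G_1)+1}=0$, and $b_2=0$ if $\alpha(G_2)=1$. *)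

(* Defs.v *)
From HB Require Import structures.
From mathcomp Require Import all_boot all_order all_algebra.
Set Implicit Arguments.
Unset Strict Implicit.
Unset Printing Implicit Defensive.
Import Order.TTheory GRing.Theory Num.Theory.
Local Open Scope ring_scope.

Record sgraph := SGraph {
  vertex :> finType;
  adj : rel vertex;
  adj_sym : symmetric adj;
  adj_irr : irreflexive adj }.

Definition independent (G : sgraph) (S : {set G}) : bool :=
  [forall x in S, forall y in S, ~~ adj x y].

Definition alpha (G : sgraph) : nat :=
  \max_(S : {set G} | independent S) #|S|.

Definition indep_num (G : sgraph) (k : nat) : nat :=
  #|[set S : {set G} | independent S & #|S| == k]|.

(* Coefficients are natural numbers, embedded in [int] so that differences
   of coefficients are not truncated. *)
Definition indep_poly (G : sgraph) : {poly int} :=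
  \poly_(k < (alpha G).+1) (indep_num G k)%:Z.

Section LexicographicProduct.
Variables G1 G2 : sgraph.

Definition lex_adj : rel (G1 * G2)%type :=
  fun u v => adj u.1 v.1 || (u.1 == v.1) && adj u.2 v.2.

Fact lex_adj_sym : symmetric lex_adj.
Proof.
by move=> u v; rewrite /lex_adj adj_sym eq_sym [adj u.2 _]adj_sym.
Qed.

Fact lex_adj_irr : irreflexive lex_adj.
Proof. by move=> u; rewrite /lex_adj !adj_irr andbF. Qed.

Definition lexprod : sgraph := SGraph lex_adj_sym lex_adj_irr.
End LexicographicProduct.

(* Both notions are meant for polynomials with nonnegative coefficients; see
   [indep_poly_ge0]. The degree of [p] is [(size p).-1]. *)
Definition log_concave (R : numDomainType) (p : {poly R}) : Prop :=
  forall k : nat, (0 < k < (size p).-1)%N ->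
    p`_k.-1 * p`_k.+1 <= p`_k ^+ 2.

Definition unimodal (R : numDomainType) (p : {poly R}) : Prop :=
  exists m : nat,
    [/\ (m <= (size p).-1)%N,
        forall k : nat, (k < m)%N -> p`_k <= p`_k.+1
      & forall k : nat, (m <= k < (size p).-1)%N -> p`_k.+1 <= p`_k].

Lemma indep_poly_ge0 (G : sgraph) (k : nat) : 0 <= (indep_poly G)`_k.
Proof. by rewrite coef_poly; case: ifP. Qed.

Lemma independent0 (G : sgraph) : independent (set0 : {set G}).
Proof. by apply/forall_inP => x; rewrite inE. Qed.

Lemma indep_num0 (G : sgraph) : indep_num G 0 = 1%N.
Proof.
rewrite -[RHS](cards1 (set0 : {set G})); congr #|pred_of_set _|.
apply/setP => S; rewrite !inE cards_eq0.
by case: eqP => [->|]; rewrite ?independent0 ?andbF.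
Qed.

Lemma indep_polyE (G : sgraph) (k : nat) :
  (indep_poly G)`_k = (indep_num G k)%:Z.
Proof.
rewrite coef_poly ltnS; case: leqP => // lt_alpha_k.
suff -> : indep_num G k = 0%N by [].
apply/eqP; rewrite cards_eq0; apply/eqP/setP => S; rewrite !inE.
apply/negP => /andP[indS /eqP cardS]; move: lt_alpha_k.
by rewrite ltnNge -cardS (leq_bigmax_cond S).
Qed.

Lemma size_indep_poly (G : sgraph) : size (indep_poly G) = (alpha G).+1.
Proof.
apply: size_poly_eq; rewrite eqz_nat -lt0n.
have [|S indS eqS] := @eq_bigmax_cond _ [pred S : {set G} | independent S]
    (fun S => #|S|).
  by apply/card_gt0P; exists set0; rewrite inE independent0.
apply/card_gt0P; exists S; rewrite !inE in indS *.
by rewrite indS /alpha /= -eqS.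
Qed.

(* Main.v *)
Require Import Defs.
From HB Require Import structures.
From mathcomp Require Import all_boot all_order all_algebra.
From mathcomp Require Import zify ring lra.
Set Implicit Arguments.
Unset Strict Implicit.
Unset Printing Implicit Defensive.
Import Order.TTheory GRing.Theory Num.Theory.
Local Open Scope ring_scope.

(** Choosing an independent set of [G1[G2]] amounts to choosing an independent
    set of [G1] and, above each of its vertices, a nonempty independent set of
    [G2].  Hence, with [q := I(G2) - 1], the polynomial [I(G1[G2])] is
    the composite [I(G1) \Po q] ([indep_poly_lexprod]).

    Write [a_0, ..., a_n] for the coefficients of [I(G1)].  Horner's scheme
    [P_n = a_n], [P_i = a_i + q P_(i+1)] ends at the composite [P_0], and the
    property wanted of [P_0] is shown of all [P_i], by induction.  As [q] has no
    constant term, adding [a_i] only fills the empty bottom place of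
    [q P_(i+1)], so that two things have to be checked.

    - Multiplication by [q] preserves the property.  Log-concavity of [I(G2)],
      whose coefficients are positive up to its degree, makes [q] a Polya
      frequency sequence of order 2, and convolution with such a sequence does
      not disturb a sign pattern [+...+ -...-] ([variation_diminishing]).
      Applied to the differences [p_j - p_(j-1)] this preserves unimodality;
      applied to all [mu p_j - lam p_(j-1)] with [mu, lam >= 0] it preserves
      the order 2 Polya frequency property, since these sign patterns
      characterise it ([pf2_twist], [twist_pf2]).

    - The new bottom coefficient fits.  The coefficients of [q P_(i+1)] of
      degree 1 and 2 are [b_1 a_(i+1)] and [b_1^2 a_(i+2) + b_2 a_(i+1)], so
      that unimodality asks for [a_i <= b_1 a_(i+1)], and log-concavity for
      [a_i (b_1^2 a_(i+2) + b_2 a_(i+1)) <= (b_1 a_(i+1))^2].  These are the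
      hypotheses of the two parts; increasing [a_i] satisfy the former because
      [b_1 >= 1] as soon as [G2] has a vertex. *)

(** * Sign patterns and Polya frequency sequences of order 2 *)

Section Sequences.
Variable R : realDomainType.
Implicit Types p q r d : {poly R}.

Definition nonneg_coefs p := forall i, 0 <= p`_i.

(** Unlike log-concavity, the bound for all pairs [i <= j] rules out positive
    coefficients separated by zeros; it says that 2 x 2 minors of the
    Toeplitz matrix of [p] are nonnegative, and this passes to products. *)
Definition pf2 p :=
  forall i j, (i <= j)%N -> p`_i * p`_j.+1 <= p`_i.+1 * p`_j.

(** The sign pattern [+...+ -...-], zeros being allowed anywhere. *)
Definition sign_desc d := forall j k, (j < k)%N -> d`_j < 0 -> d`_k <= 0.

(** Each step moves the two indices one unit towards each other; they do not
    cross as long as [s.*2 <= n]. *)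
Lemma pf2_gap p x n s :
  pf2 p -> (s.*2 <= n)%N -> p`_x * p`_(x + n) <= p`_(x + s) * p`_(x + (n - s)).
Proof.
move=> pf; elim: s => [|s IH] le_s; first by rewrite addn0 subn0.
apply: le_trans (IH _) _; first by lia.
have := pf (x + s)%N (x + (n - s.+1))%N.
have -> : (x + (n - s.+1)).+1 = (x + (n - s))%N by lia.
by rewrite addnS; apply; lia.
Qed.

(** With this matrix convolution by [r] becomes a sum over a range of [j] that
    does not depend on [k], so that two output indices can be compared termwise. *)
Definition toeplitz r k j : R := if (j <= k)%N then r`_(k - j) else 0.

(** When no entry vanishes, the two products have the same index sum, and the
    indices on the right lie between those on the left. *)
Lemma toeplitz_tp2 r k k' j j' : nonneg_coefs r -> pf2 r ->
  (k < k')%N -> (j < j')%N ->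
  toeplitz r k j' * toeplitz r k' j <= toeplitz r k j * toeplitz r k' j'.
Proof.
move=> r0 pf lt_k lt_j; rewrite /toeplitz.
have [le_j'k|_] := leqP j' k; last first.
  by rewrite mul0r; do 2!case: ifP => _; rewrite ?mulr0 ?mul0r ?mulr_ge0.
have [-> -> ->] : [/\ (j <= k)%N, (j <= k')%N & (j' <= k')%N] by split; lia.
have gap s := @pf2_gap r (k - j') (k' - j - (k - j')) s pf.
(* The inner pair is reached by moving by the smaller of the two gaps, which
   is at most half of the distance between the outer indices. *)
have [le_jk|lt_kj] := leqP (j' - j) (k' - k).
  have := gap (j' - j)%N ltac:(lia).
  by congr (_ * r`_ _ <= r`_ _ * r`_ _); lia.
have := gap (k' - k)%N ltac:(lia).
rewrite [X in _ <= X]mulrC.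
by congr (_ * r`_ _ <= r`_ _ * r`_ _); lia.
Qed.

Lemma coefM_toeplitz d r k n : (k < n)%N ->
  (d * r)`_k = \sum_(j < n) d`_j * toeplitz r k j.
Proof.
move=> lt_kn; rewrite coefM (big_ord_widen n (fun j => d`_j * r`_(k - j))) //.
rewrite big_mkcond; apply: eq_bigr => j _; rewrite /toeplitz ltnS.
by case: ifP; rewrite ?mulr0.
Qed.

(** Split [d] into its positive and negative parts, and the product accordingly
    into [A - B].  Where the positive part lives is below where the negative
    part lives, so total positivity gives [A_k' B_k <= A_k B_k'] for [k < k'];
    if [A_k < B_k] then dividing by [B_k > 0] yields [A_k' <= B_k']. *)
Lemma variation_diminishing d r :
  nonneg_coefs r -> pf2 r -> sign_desc d -> sign_desc (d * r).
Proof.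
move=> r0 pf sd k k' lt_kk'.
rewrite (coefM_toeplitz _ _ (leqW lt_kk')) (coefM_toeplitz _ _ (ltnSn k')).
pose K := toeplitz r; pose dp j := Num.max d`_j 0; pose dn j := Num.max (- d`_j) 0.
pose A l := \sum_(j < k'.+1) dp j * K l j.
pose B l := \sum_(j < k'.+1) dn j * K l j.
have dE j : d`_j = dp j - dn j.
  by rewrite /dp /dn; case: (ltrP d`_j 0); case: (ltrP (- d`_j) 0); lra.
have K0 l j : 0 <= K l j by rewrite /K /toeplitz; case: ifP.
have dp0 j : 0 <= dp j by rewrite le_max lexx orbT.
have dn0 j : 0 <= dn j by rewrite le_max lexx orbT.
have eE l : \sum_(j < k'.+1) d`_j * toeplitz r l j = A l - B l.
  by rewrite -sumrB; apply: eq_bigr => j _; rewrite dE mulrBl.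
have B0 l : 0 <= B l by apply: sumr_ge0 => j _; apply: mulr_ge0.
have A0 l : 0 <= A l by apply: sumr_ge0 => j _; apply: mulr_ge0.
have cross : A k' * B k <= A k * B k'.
  rewrite !big_distrlr; apply: ler_sum => i _; apply: ler_sum => j _ /=.
  rewrite mulrACA [X in _ <= X]mulrACA.
  have [->|dpi] := eqVneq (dp i) 0; first by rewrite !mul0r.
  have [->|dnj] := eqVneq (dn j) 0; first by rewrite mulr0 !mul0r.
  apply: ler_wpM2l; first exact: mulr_ge0.
  rewrite mulrC; apply: toeplitz_tp2 => //.
  (* Only terms with [d`_i > 0 > d`_j] remain, and the sign pattern of [d]
     forces [i < j] for those. *)
  have di : 0 < d`_i by rewrite ltNge; apply: contra_neqN dpi => /max_idPr.
  have dj : d`_j < 0.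
    by rewrite ltNge; apply: contra_neqN dnj => dj; apply/max_idPr; rewrite oppr_le0.
  have [//|lt_ji|/val_inj eq_ij] := ltngtP i j.
    by have := lt_le_trans di (sd _ _ lt_ji dj); rewrite ltxx.
  by move: di; rewrite eq_ij => /(lt_trans dj); rewrite ltxx.
rewrite !eE subr_lt0 subr_le0 => ltAB.
have Bk : 0 < B k by apply: le_lt_trans ltAB.
rewrite -(ler_pM2r Bk); apply: le_trans cross _.
by rewrite [B k' * _]mulrC ler_wpM2r // ltW.
Qed.

(** Being a factor, [mu - lam X] can be carried across any product. *)
Definition twist mu lam : {poly R} := mu%:P - lam%:P * 'X.

Lemma coef_twist0 mu lam p : (twist mu lam * p)`_0 = mu * p`_0.
Proof. by rewrite mulrBl coefB coefCM -mulrA coefCM coefXM mulr0 subr0. Qed.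

Lemma coef_twistS mu lam p k :
  (twist mu lam * p)`_k.+1 = mu * p`_k.+1 - lam * p`_k.
Proof. by rewrite mulrBl coefB coefCM -mulrA coefCM coefXM. Qed.

Lemma pf2_twist p mu lam : nonneg_coefs p -> pf2 p ->
  0 <= mu -> 0 <= lam -> sign_desc (twist mu lam * p).
Proof.
move=> p0 pf mu0 lam0 [|j] [|k] // lt_jk; first by rewrite coef_twist0 ltNge mulr_ge0.
rewrite !coef_twistS subr_lt0 subr_le0 => lt_j.
have pj : 0 < p`_j.
  rewrite lt_neqAle p0 andbT; apply/eqP => pj0.
  by move: lt_j; rewrite -pj0 mulr0 ltNge mulr_ge0.
rewrite -(ler_pM2r pj) -mulrA [p`_k.+1 * _]mulrC.
apply: le_trans (ler_wpM2l mu0 (pf j k (ltnW lt_jk))) _.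
by rewrite mulrA [X in _ <= X]mulrAC ler_wpM2r // ltW.
Qed.

(** If the minor on [i < j] were negative, the weights obtained by adding the
    two columns, [mu = p_i + p_j] and [lam = p_(i+1) + p_(j+1)], would make
    the twisted coefficient negative at [i + 1] and positive at [j + 1]. *)
Lemma twist_pf2 p : nonneg_coefs p ->
  (forall mu lam, 0 <= mu -> 0 <= lam -> sign_desc (twist mu lam * p)) -> pf2 p.
Proof.
move=> p0 sd i j; rewrite leq_eqVlt => /predU1P[->|lt_ij]; first by rewrite mulrC.
rewrite leNgt; apply/negP => bad.
have := sd (p`_i + p`_j) (p`_i.+1 + p`_j.+1) (addr_ge0 (p0 _) (p0 _))
  (addr_ge0 (p0 _) (p0 _)) i.+1 j.+1 lt_ij.
rewrite !coef_twistS => /(_ ltac:(lra)); lra.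
Qed.

Lemma nonneg_coefsM p q : nonneg_coefs p -> nonneg_coefs q -> nonneg_coefs (p * q).
Proof.
by move=> p0 q0 k; rewrite coefM; apply: sumr_ge0 => j _; apply: mulr_ge0.
Qed.

Lemma pf2M p q : nonneg_coefs p -> nonneg_coefs q -> pf2 p -> pf2 q -> pf2 (p * q).
Proof.
move=> p0 q0 pfp pfq; apply: twist_pf2 => [|mu lam mu0 lam0].
  exact: nonneg_coefsM.
by rewrite mulrA; apply: variation_diminishing => //; apply: pf2_twist.
Qed.

(** Positivity up to the degree is what allows the local inequalities to be
    chained, by cancelling [p_k]. *)
Lemma log_concave_pf2 p : nonneg_coefs p ->
  (forall i, (i < size p)%N -> 0 < p`_i) -> log_concave p -> pf2 p.
Proof.
move=> p0 pos lc i j /subnKC <-; elim: (j - i)%N => [|n IH].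
  by rewrite addn0 mulrC.
set k := (i + n)%N in IH *; rewrite addnS -/k.
have [le_sz|lt_sz] := leqP (size p) k.+2.
  by rewrite (nth_default _ le_sz) mulr0 mulr_ge0.
have pk : 0 < p`_k by apply: pos; lia.
have lt_k : (0 < k.+1 < (size p).-1)%N by rewrite ltn_predRL.
have := lc k.+1 lt_k; rewrite /= expr2 => lck.
rewrite -(ler_pM2r pk) -mulrA [p`_k.+2 * _]mulrC.
apply: le_trans (ler_wpM2l (p0 i) lck) _.
by rewrite mulrA [X in _ <= X]mulrAC ler_wpM2r.
Qed.

Lemma pf2_log_concave p : pf2 p -> log_concave p.
Proof. by move=> pf [|k] // _; rewrite expr2; apply: pf. Qed.

(** The mode is the first index at which [p] strictly decreases; it exists
    for [p != 0] because the leading coefficient is followed by 0. *)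
Lemma sign_desc_unimodal p :
  nonneg_coefs p -> sign_desc (twist 1 1 * p) -> unimodal p.
Proof.
move=> p0 sd; have [->|pn0] := eqVneq p 0.
  by exists 0%N; rewrite size_poly0; split=> // k; rewrite andbF.
have ex : exists k, p`_k.+1 < p`_k.
  exists (size p).-1; rewrite prednK ?size_poly_gt0 // nth_default //.
  by rewrite lt_neqAle p0 eq_sym -/(lead_coef p) lead_coef_eq0 pn0.
have [m ltm minm] := ex_minnP ex; exists m; split=> [|k lt_km|k /andP[]].
- rewrite leqNgt; apply/negP => lt_m.
  move: ltm; rewrite [p`_m]nth_default ?ltNge ?p0 //.
  exact: leq_trans (leqSpred _) lt_m.
- by rewrite leNgt; apply/negP => /minm; rewrite leqNgt lt_km.
rewrite leq_eqVlt => /predU1P[<- _|lt_mk _]; first exact: ltW.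
have := sd m.+1 k.+1 lt_mk; rewrite !coef_twistS !mul1r subr_lt0 subr_le0.
exact.
Qed.

(** Only the minors on the new bottom coefficient are new, and for [a >= 0] the
    one in degree 1 implies the others, since
    [a p_(j+1) p_1 <= a p_2 p_j <= p_1^2 p_j]; for [a < 0] they are trivial. *)
Lemma pf2_add_const a p : nonneg_coefs p -> pf2 p ->
  p`_0 = 0 -> 0 < p`_1 -> a * p`_2 <= p`_1 ^+ 2 -> pf2 (a%:P + p).
Proof.
move=> p0 pf p00 p1 le_a [|i] [|j] //; rewrite !coefD !coefC ?addr0 ?add0r //= => le_ij.
- by rewrite mulrC.
- rewrite p00 addr0; case: j {le_ij} => [|j]; first by rewrite -expr2.
  rewrite -(ler_pM2r p1) -mulrA [p`_j.+3 * _]mulrC.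
  have [a0|a_lt0] := lerP 0 a.
    apply: le_trans (ler_wpM2l a0 (pf 1%N j.+2 isT)) _.
    by rewrite mulrA [X in _ <= X]mulrAC -expr2 ler_wpM2r.
  apply: le_trans (_ : _ <= 0) _; last by rewrite !mulr_ge0 // ltW.
  by rewrite nmulr_rle0 // mulr_ge0.
- exact: pf.
Qed.

(** * Composition by Horner's scheme *)

Lemma comp_Poly_cons a s q : Poly (a :: s) \Po q = a%:P + q * (Poly s \Po q).
Proof.
by rewrite /= cons_poly_def comp_polyD comp_polyC comp_polyM comp_polyX addrC mulrC.
Qed.

Lemma coef0_comp_Poly s q : q`_0 = 0 -> (Poly s \Po q)`_0 = s`_0.
Proof.
case: s => [|a s] q0; first by rewrite /= comp_poly0 coef0.
by rewrite comp_Poly_cons coefD coefC coef0M q0 mul0r addr0.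
Qed.

Lemma coef1_mul q p : q`_0 = 0 -> (q * p)`_1 = q`_1 * p`_0.
Proof. by move=> q0; rewrite coefM !big_ord_recl big_ord0 /= q0 mul0r add0r addr0. Qed.

Lemma coef2_mul q p : q`_0 = 0 -> (q * p)`_2 = q`_1 * p`_1 + q`_2 * p`_0.
Proof. by move=> q0; rewrite coefM !big_ord_recl big_ord0 /= q0 mul0r add0r addr0. Qed.

Lemma coef1_comp_Poly s q : q`_0 = 0 -> (Poly s \Po q)`_1 = q`_1 * s`_1.
Proof.
case: s => [|a s] q0; first by rewrite /= comp_poly0 coef0 mulr0.
by rewrite comp_Poly_cons coefD coefC coef1_mul // coef0_comp_Poly ?add0r.
Qed.

Lemma nonneg_comp_Poly s q : nonneg_coefs q ->
  (forall i, 0 <= s`_i) -> nonneg_coefs (Poly s \Po q).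
Proof.
move=> q0; elim: s => [|a s IH] s0; first by move=> k; rewrite /= comp_poly0 coef0.
move=> k; rewrite comp_Poly_cons coefD coefC addr_ge0 //.
  by case: k => //=; apply: (s0 0%N).
by apply: nonneg_coefsM => //; apply: IH => i; apply: (s0 i.+1).
Qed.

(** The inequality on [s] is the one that [pf2_add_const] asks for at each step
    of Horner's scheme; positivity of [s] makes the coefficient of degree 1
    positive there, so that zeros never separate the new constant term from
    the rest. *)
Lemma pf2_comp_Poly s q :
    nonneg_coefs q -> pf2 q -> q`_0 = 0 -> 0 < q`_1 ->
    (forall i, (i < size s)%N -> 0 < s`_i) ->
    (forall i, (i.+1 < size s)%N ->
      s`_i * (q`_1 ^+ 2 * s`_i.+2 + q`_2 * s`_i.+1) <= (q`_1 * s`_i.+1) ^+ 2) ->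
  pf2 (Poly s \Po q).
Proof.
move=> qge0 pfq q0 q1; elim: s => [|a s IH] pos cond.
  by move=> i j _; rewrite /= comp_poly0 !coef0 mul0r.
case: s IH pos cond => [|b s] IH pos cond.
  rewrite comp_Poly_cons /= comp_poly0 mulr0 addr0 => i j _.
  by rewrite !coefC /= mulr0 mul0r.
have pos' i : (i < size (b :: s))%N -> 0 < (b :: s)`_i by apply: (pos i.+1).
have ge0 i : 0 <= (b :: s)`_i.
  have [/pos'/ltW//|le_i] := ltnP i (size (b :: s)).
  by rewrite nth_default.
have p0 : nonneg_coefs (Poly (b :: s) \Po q) by apply: nonneg_comp_Poly.
rewrite comp_Poly_cons; apply: pf2_add_const.
- exact: nonneg_coefsM.
- apply: pf2M => //; apply: IH => // i; exact: (cond i.+1).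
- by rewrite coef0M q0 mul0r.
- by rewrite coef1_mul // coef0_comp_Poly // mulr_gt0 //; apply: (pos' 0%N).
have := cond 0%N isT.
rewrite coef1_mul // coef2_mul // coef0_comp_Poly // coef1_comp_Poly //.
by rewrite mulrA -expr2.
Qed.

(** At each step of Horner's scheme the sequence of differences, after
    multiplication by [q], changes only in degrees 0 and 1, where the
    inequality on [s] keeps it nonnegative; the innermost step has no next
    entry, and its differences are just [a] and [- a]. *)
Lemma sign_desc_comp_Poly s q :
    nonneg_coefs q -> pf2 q -> q`_0 = 0 ->
    (forall i, 0 <= s`_i) ->
    (forall i, (i.+1 < size s)%N -> s`_i <= q`_1 * s`_i.+1) ->
  sign_desc (twist 1 1 * (Poly s \Po q)).
Proof.
move=> qge0 pfq q0; elim: s => [|a s IH] ge0 cond.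
  by move=> j k _; rewrite /= comp_poly0 mulr0 coef0 ltxx.
have sd : sign_desc (twist 1 1 * (q * (Poly s \Po q))).
  rewrite mulrCA mulrC; apply: variation_diminishing => //.
  apply: IH => i; [exact: (ge0 i.+1) | exact: (cond i.+1)].
rewrite comp_Poly_cons; set c := q * _ in sd *.
have c0 : c`_0 = 0 by rewrite coef0M q0 mul0r.
move=> [|j] [|k] //.
  by rewrite coef_twist0 mul1r coefD coefC c0 addr0 ltNge (ge0 0%N).
have twistE l : (twist 1 1 * (a%:P + c))`_l.+2 = (twist 1 1 * c)`_l.+2.
  by rewrite !coef_twistS !coefD !coefC !add0r.
case: k => // k; rewrite twistE; case: j => [_|j]; last by rewrite twistE; apply: sd.
case: s {IH ge0} cond @c {sd} c0 {twistE} => [|b s] cond c c0.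
  by rewrite /c /= comp_poly0 !mulr0 coef0.
rewrite coef_twistS !mul1r !coefD !coefC c0 add0r addr0 coef1_mul //.
by rewrite coef0_comp_Poly // subr_lt0 ltNge (cond 0%N).
Qed.
End Sequences.

(** * Independence polynomial of a lexicographic product *)

Lemma indep_polyE_sum G :
  indep_poly G = \sum_(S : {set G} | independent S) 'X^#|S|.
Proof.
apply/polyP => k; rewrite indep_polyE coef_sum /indep_num -sum1_card.
rewrite [RHS](eq_bigr (fun S : {set G} => if #|S| == k then 1 else 0)); last first.
  by move=> S _; rewrite coefXn eq_sym; case: eqP.
rewrite -[RHS]big_mkcondr /= -natz natr_sum.
by apply: eq_bigl => S; rewrite inE.
Qed.

(** The [k]-subsets of a maximum independent set are independent. *)
Lemma indep_num_gt0 G k : (k <= alpha G)%N -> (0 < indep_num G k)%N.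
Proof.
move=> le_k.
have [|S indS eqS] := @eq_bigmax_cond _ [pred S : {set G} | independent S]
    (fun S => #|S|).
  by apply/card_gt0P; exists set0; rewrite inE independent0.
rewrite /alpha [X in (_ <= X)%N]eqS in le_k.
apply: leq_trans (_ : 'C(#|S|, k) <= _)%N; first by rewrite bin_gt0.
rewrite -cards_draws; apply: subset_leq_card; apply/subsetP => A.
rewrite !inE => /andP[/subsetP sAS ->]; rewrite andbT.
move: indS; rewrite inE => /forall_inP indS.
apply/forall_inP => x /sAS/indS/forall_inP indx.
by apply/forall_inP => y /sAS/indx.
Qed.

Section LexicographicProduct.
Variables G1 G2 : sgraph.

Definition fibres (T : {set lexprod G1 G2}) : {ffun G1 -> {set G2}} :=
  [ffun a => [set x | (a, x) \in T]].

Definition supp (f : {ffun G1 -> {set G2}}) := [set a | f a != set0].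

Definition glue (f : {ffun G1 -> {set G2}}) : {set lexprod G1 G2} :=
  [set u | u.2 \in f u.1].

Lemma fibresK : cancel fibres glue.
Proof. by move=> T; apply/setP => -[a x]; rewrite inE ffunE inE. Qed.

Lemma glueK : cancel glue fibres.
Proof. by move=> f; apply/ffunP => a; rewrite ffunE; apply/setP => x; rewrite !inE. Qed.

Lemma card_glue f : #|glue f| = (\sum_a #|f a|)%N.
Proof.
rewrite -sum1_card (eq_bigr (fun a => \sum_(x in f a) 1)%N); last first.
  by move=> a _; rewrite sum1_card.
by rewrite pair_big_dep /=; apply: eq_bigl => u; rewrite inE.
Qed.

Lemma independent_glue f :
  independent (glue f) = [forall a, independent (f a)] && independent (supp f).
Proof.
apply/forall_inP/andP => [ind|[/forallP indf /forall_inP inds] [a x]].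
  split.
    apply/forallP => a; apply/forall_inP => x fx; apply/forall_inP => y fy.
    have /forall_inP/(_ (a, y)) := ind (a, x) ltac:(by rewrite inE).
    by rewrite inE => /(_ fy); rewrite /= /lex_adj /= adj_irr eqxx.
  apply/forall_inP => a; rewrite inE => /set0Pn[x fx].
  apply/forall_inP => b; rewrite inE => /set0Pn[y fy].
  have /forall_inP/(_ (b, y)) := ind (a, x) ltac:(by rewrite inE).
  by rewrite inE => /(_ fy); rewrite /= /lex_adj /= negb_or => /andP[].
rewrite inE /= => fx; apply/forall_inP => -[b y]; rewrite inE /= => fy.
rewrite /lex_adj /= negb_or; apply/andP; split.
  have /forall_inP := inds a ltac:(by rewrite inE; apply/set0Pn; exists x).
  by apply; rewrite inE; apply/set0Pn; exists y.
case: eqP => //= eq_ab; rewrite -eq_ab in fy.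
by have /forall_inP/(_ x fx)/forall_inP := indf a; apply.
Qed.

(** Sort the independent sets by their projection [S] to [G1]: above a vertex of
    [S] the fibre ranges over the nonempty independent sets of [G2], which
    contributes [I(G2) - 1], and elsewhere the fibre is empty, which
    contributes 1.  Expanding the product of these sums over the vertices of
    [G1] gives back the sum over all families of fibres. *)
Lemma indep_poly_lexprod :
  indep_poly (lexprod G1 G2) = indep_poly G1 \Po (indep_poly G2 - 1).
Proof.
rewrite !indep_polyE_sum raddf_sum /=.
rewrite (reindex glue) /=; last by exists fibres => ? _; rewrite ?glueK ?fibresK.
under eq_bigl do rewrite independent_glue.
rewrite (partition_big supp (@independent G1)) /= => [|f /andP[]//].
apply: eq_bigr => S indS; rewrite comp_Xn_poly.
have nonempty : \sum_(U : {set G2} | independent U && (U != set0)) 'X^#|U|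
    = \sum_(U : {set G2} | independent U) 'X^#|U| - 1 :> {poly int}.
  by rewrite [in RHS](bigD1 set0) ?independent0 //= cards0 expr0 [RHS]addrC addKr.
rewrite -nonempty -prodr_const [RHS]big_mkcond /=.
pose P a (U : {set G2}) := independent U && ((U != set0) == (a \in S)).
rewrite [RHS](eq_bigr (fun a => \sum_(U | P a U) 'X^#|U|)); last first.
  move=> a _; rewrite /P; case: (a \in S); first by apply: eq_bigl => U; rewrite eqb_id.
  rewrite (big_pred1 set0) ?cards0 // => U; rewrite eqbF_neg negbK /=.
  by case: eqP => [->|]; rewrite ?independent0 ?andbF.
rewrite bigA_distr_big_dep; apply: eq_big => [f|f _]; last first.
  by rewrite card_glue -prodrXr.
apply/andP/familyP => [[/andP[/forallP indf _] /eqP suppE] a|fam].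
  by rewrite unfold_in /P indf -suppE inE eqxx.
have suppE : supp f = S.
  by apply/setP => a; have := fam a; rewrite unfold_in inE => /andP[_ /eqP].
split; last by rewrite suppE.
rewrite suppE indS andbT; apply/forallP => a.
by have := fam a; rewrite unfold_in => /andP[].
Qed.
End LexicographicProduct.

(** * The two criteria *)

Theorem theorem2p2 (G1 G2 : sgraph) :
  let a := indep_poly G1 in
  let b := indep_poly G2 in
  (log_concave a -> log_concave b ->
   (forall i : nat, (1 <= i <= alpha G1)%N ->
      a`_i * a`_i.-1 * b`_2 <= (a`_i ^+ 2 - a`_i.-1 * a`_i.+1) * b`_1 ^+ 2) ->
   log_concave (indep_poly (lexprod G1 G2)))
  /\
  (log_concave b ->
   ((forall i : nat, (1 <= i <= alpha G1)%N -> a`_i.-1 <= b`_1 * a`_i) ->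
    unimodal (indep_poly (lexprod G1 G2)))
   /\
   ((forall i : nat, (1 <= i <= alpha G1)%N -> a`_i.-1 <= a`_i) ->
    unimodal (indep_poly (lexprod G1 G2)))).
Proof.
move=> a b.
have pos G i : (i < size (indep_poly G))%N -> 0 < (indep_poly G)`_i.
  by rewrite size_indep_poly ltnS indep_polyE => /indep_num_gt0.
pose q := b - 1.
have lexE : indep_poly (lexprod G1 G2) = Poly a \Po q.
  by rewrite indep_poly_lexprod polyseqK.
have q0 : q`_0 = 0 by rewrite coefB coef1 indep_polyE indep_num0.
have qS i : q`_i.+1 = b`_i.+1 by rewrite coefB coef1 subr0.
have qge0 : nonneg_coefs q by case=> [|i]; rewrite ?q0 ?qS ?indep_poly_ge0.
have pfq : log_concave b -> pf2 q.
  move=> lcb; have pfb := log_concave_pf2 (@indep_poly_ge0 G2) (@pos G2) lcb.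
  move=> [|i] [|j] // le_ij; rewrite ?q0 ?mul0r ?mulr_ge0 // !qS.
  exact: pfb.
(* If [G2] has no vertices then [q = 0] and the composite is constant. *)
have [alpha0|alpha_gt0] := posnP (alpha G2).
  have -> : indep_poly (lexprod G1 G2) = (a`_0)%:P.
    suff q_eq0 : q = 0 by rewrite lexE polyseqK q_eq0 comp_poly0r.
    apply/polyP => -[|i]; rewrite ?q0 ?qS ?coef0 // nth_default //.
    by rewrite size_indep_poly alpha0.
  have sz : (size (a`_0)%:P).-1 = 0%N by rewrite size_polyC; case: eqP.
  have uni : unimodal (a`_0)%:P by exists 0%N; rewrite sz; split=> // k; rewrite andbF.
  by split=> [_ _ _ k|]; rewrite ?sz ?andbF.
have b1 : 0 < b`_1 by apply: pos; rewrite size_indep_poly.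
have uni : log_concave b ->
    (forall i : nat, (1 <= i <= alpha G1)%N -> a`_i.-1 <= b`_1 * a`_i) ->
    unimodal (indep_poly (lexprod G1 G2)).
  move=> lcb cond; apply: sign_desc_unimodal; first exact: indep_poly_ge0.
  rewrite lexE; apply: sign_desc_comp_Poly => //; first exact: pfq.
    exact: indep_poly_ge0.
  by move=> i; rewrite size_indep_poly ltnS qS => lt_i; apply: (cond i.+1).
split=> [_ lcb cond|lcb]; last first.
  split; first exact: uni.
  move=> mono; apply: uni => // i le_i; apply: le_trans (mono i le_i) _.
  by rewrite ler_peMl ?indep_poly_ge0 // -gtz0_ge1.
rewrite lexE; apply: pf2_log_concave; apply: pf2_comp_Poly => //.
- exact: pfq.
- by rewrite qS.
- exact: pos.
move=> i; rewrite size_indep_poly ltnS !qS => lt_i.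
rewrite -subr_ge0; have := cond i.+1 lt_i; rewrite /= -subr_ge0.
by congr (0 <= _); ring.
Qed.
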